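(* Let $(M,g,q)$ be a four-dimensional Riemannian manifold with circulant metric $g$ and circulant structure $q$ as defined in the context, and let $p\in M$. Suppose $x\in T_pM$ induces a $q$-basis of $T_pM$. Then there exists an orthogonal $q$-basis of $T_pM$, i.e. there exists a vector $y\in T_pM$ such that $\{y, qy, q^{2}y, q^{3}y\}$ is a basis of $T_pM$ whose elements are pairwise orthogonal with respect to $g$.
   Context: Setting: $M$ is a four-dimensional smooth manifold with a Riemannian metric $g$ and an endomorphism field $q$ of the tangent bundle such that near every point there are local coordinates $(X^1,X^2,X^3,X^4)$ in which $$(g_{ij})=\begin{pmatrix} A & B & C & B\\ B & A & B & C\\ C & B & A & B\\ B & C & B & A\end{pmatrix},$$ where $A,B,C$ are smooth functions with $0<B<C<A$ (this makes $g$ positive definite), and $q$ has the constant matrix $$(q_i^s)=\begin{pmatrix}0&1&0&0\\0&0&1&0\\0&0&0&1\\1&0&0&0\end{pmatrix},$$ so that for a tangent vector with coordinates $x=(x^1,x^2,x^3,x^4)$ one has $qx=(x^2,x^3,x^4,x^1)$. In particular $q^4=\mathrm{id}$ and $q^2\neq\pm\mathrm{id}$. Such a manifold is denoted $(M,g,q)$. A basis of $T_pM$ of the form $\{x,qx,q^2x,q^3x\}$ is called a $q$-basis; in this case one says that $x$ induces a $q$-basis of $T_pM$. *)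

(* Defs.v *)
From HB Require Import structures.
From mathcomp Require Import all_boot all_order all_algebra.
From mathcomp Require Import all_classical all_reals all_analysis.

Set Implicit Arguments.
Unset Strict Implicit.
Unset Printing Implicit Defensive.

Import Order.TTheory GRing.Theory Num.Theory.
Import numFieldNormedType.Exports.

Local Open Scope classical_set_scope.
Local Open Scope ring_scope.

(* For open U.  As the source is finite-dimensional, the derivative x |-> 'd f x
   is C^k exactly when each of its evaluations x |-> 'd f x v is. *)
Fixpoint Ck_on (R : realType) (V W : normedModType R) (k : nat)
    (U : set V) (f : V -> W) : Prop :=
  match k with
  | 0%N => forall x, U x -> {for x, continuous f}
  | k'.+1 => (forall x, U x -> differentiable f x) /\
             (forall v, Ck_on k' U (fun x => 'd f x v))
  end.

Definition smooth_on (R : realType) (V W : normedModType R)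
    (U : set V) (f : V -> W) : Prop := forall k, Ck_on k U f.

(* [cmap] and [cinv] are total functions; only their values on [cdom] and
   [cmap @` cdom] are meaningful. *)
Record chart (R : realType) (M : topologicalType) := Chart {
  cdom : set M ;
  cmap :> M -> 'rV[R]_4 ;
  cinv : 'rV[R]_4 -> M ;
  cdom_open : open cdom ;
  cimg_open : open (cmap @` cdom) ;
  cmapK : forall p, cdom p -> cinv (cmap p) = p ;
  cmap_cts : {within cdom, continuous cmap} ;
  cinv_cts : {within cmap @` cdom, continuous cinv}
}.

Definition cimg (R : realType) (M : topologicalType) (c : chart R M) :
  set 'rV[R]_4 := c @` cdom c.

Definition transition (R : realType) (M : topologicalType) (c c' : chart R M) :
  'rV[R]_4 -> 'rV[R]_4 := fun X => c' (cinv c X).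

Definition compatible (R : realType) (M : topologicalType) (c c' : chart R M) :=
  smooth_on (c @` (cdom c `&` cdom c')) (transition c c') /\
  smooth_on (c' @` (cdom c `&` cdom c')) (transition c' c).

Record manifold4 (R : realType) := Manifold4 {
  carrier :> topologicalType ;
  carrier_hausdorff : hausdorff_space carrier ;
  carrier_second_countable : @second_countable carrier ;
  atlas : set (chart R carrier) ;
  atlas_cover : forall p, exists2 c, atlas c & cdom c p ;
  atlas_compatible : forall c c', atlas c -> atlas c' -> compatible c c' ;
  atlas_maximal :
    forall c, (forall c', atlas c' -> compatible c c') -> atlas c
}.

Definition chart_at (R : realType) (M : manifold4 R) (p : M) :
  set (chart R M) := [set c | atlas c /\ cdom c p].

(* A tangent vector at p is the family of its coordinates in all the charts of
   the atlas around p, related by the contravariant transformation law.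
   Coordinates in the other charts are set to 0, so that Leibniz equality of
   families is equality of tangent vectors. *)
Definition is_tangent (R : realType) (M : manifold4 R) (p : M)
    (v : chart R M -> 'rV[R]_4) : Prop :=
  (forall c, ~ chart_at p c -> v c = 0) /\
  (forall c c', chart_at p c -> chart_at p c' ->
     v c' = 'd (transition c c') (c p) (v c)).

Definition tangent_pred (R : realType) (M : manifold4 R) (p : M) :
  {pred (chart R M -> 'rV[R]_4)} := [pred v | `[< is_tangent p v >]].

Lemma tangent_submod (R : realType) (M : manifold4 R) (p : M) :
  submod_closed (tangent_pred p).
Proof.
split=> [|a u v /asboolP[u0 uE] /asboolP[v0 vE]]; apply/asboolP; split=> //.
- by move=> c c' _ _; rewrite /= linear0.
- by move=> c Nc; rewrite -[LHS]/(a *: u c + v c) u0 // v0 // scaler0 addr0.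
- move=> c c' hc hc'.
  have E d : (a *: u + v) d = a *: u d + v d by [].
  by rewrite !E linearP (uE _ _ hc hc') (vE _ _ hc hc').
Qed.

HB.instance Definition _ (R : realType) (M : manifold4 R) (p : M) :=
  GRing.isSubmodClosed.Build R (chart R M -> 'rV[R]_4) (tangent_pred p)
    (@tangent_submod R M p).

Record tangent (R : realType) (M : manifold4 R) (p : M) := Tangent {
  coord :> chart R M -> 'rV[R]_4 ;
  coordP : coord \in tangent_pred p
}.

HB.instance Definition _ (R : realType) (M : manifold4 R) (p : M) :=
  [isSub for @coord R M p].
HB.instance Definition _ (R : realType) (M : manifold4 R) (p : M) :=
  [Choice of tangent p by <:].
HB.instance Definition _ (R : realType) (M : manifold4 R) (p : M) :=
  [SubChoice_isSubLmodule of tangent p by <:].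

Definition metric_in_chart (R : realType) (M : manifold4 R)
    (g : forall p : M, tangent p -> tangent p -> R)
    (c : chart R M) (G : 'rV[R]_4 -> 'M[R]_4) : Prop :=
  forall p, cdom c p -> forall u v : tangent p,
    g p u v = \sum_(i < 4) \sum_(j < 4) G (c p) i j * u c 0 i * v c 0 j.

(* Coordinates are rows, but the matrix acts as on columns:
   the i-th coordinate of q v is \sum_s Q i s * v^s. *)
Definition endo_in_chart (R : realType) (M : manifold4 R)
    (q : forall p : M, tangent p -> tangent p)
    (c : chart R M) (Q : 'rV[R]_4 -> 'M[R]_4) : Prop :=
  forall p, cdom c p -> forall v : tangent p,
    q p v c = v c *m (Q (c p))^T.

Definition smooth_mx_on (R : realType) (U : set 'rV[R]_4)
    (G : 'rV[R]_4 -> 'M[R]_4) : Prop :=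
  forall i j, smooth_on U (fun X => G X i j : R^o).

Record riemannian_metric (R : realType) (M : manifold4 R) := RiemannianMetric {
  metric :> forall p : M, tangent p -> tangent p -> R ;
  metric_sym : forall p (u v : tangent p), metric u v = metric v u ;
  metric_linear : forall p (u : tangent p), scalar (metric u) ;
  metric_pos : forall p (u : tangent p), u != 0 -> 0 < metric u u ;
  metric_smooth : forall c, atlas c ->
    exists2 G, smooth_mx_on (cimg c) G & metric_in_chart metric c G
}.

Record endo_field (R : realType) (M : manifold4 R) := EndoField {
  endo :> forall p : M, tangent p -> tangent p ;
  endo_linear : forall p : M, linear (@endo p) ;
  endo_smooth : forall c, atlas c ->
    exists2 Q, smooth_mx_on (cimg c) Q & endo_in_chart endo c Q
}.

Definition mx4 (R : realType) (rows : seq (seq R)) : 'M[R]_4 :=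
  \matrix_(i, j) nth 0 (nth [::] rows i) j.

Definition metric_mx (R : realType) (A B C : R) : 'M[R]_4 :=
  mx4 [:: [:: A; B; C; B];
          [:: B; A; B; C];
          [:: C; B; A; B];
          [:: B; C; B; A]].

Definition q_mx (R : realType) : 'M[R]_4 :=
  mx4 [:: [:: 0; 1; 0; 0];
          [:: 0; 0; 1; 0];
          [:: 0; 0; 0; 1];
          [:: 1; 0; 0; 0]].

(* The atlas is maximal, so its charts are all the smooth local coordinate
   systems of M. *)
Definition circulant_structure (R : realType) (M : manifold4 R)
    (g : riemannian_metric M) (q : endo_field M) : Prop :=
  forall p : M, exists c, chart_at p c /\
    exists A B C : 'rV[R]_4 -> R^o,
      [/\ [/\ smooth_on (cimg c) A, smooth_on (cimg c) B
            & smooth_on (cimg c) C],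
          (forall X, cimg c X -> [/\ 0 < B X, B X < C X & C X < A X]),
          metric_in_chart g c (fun X => metric_mx (A X) (B X) (C X))
        & endo_in_chart q c (fun=> q_mx R)].

Definition is_basis (R : realType) (V : lmodType R) (n : nat)
    (e : 'I_n -> V) : Prop :=
  (forall a : 'I_n -> R, \sum_(i < n) a i *: e i = 0 -> forall i, a i = 0) /\
  (forall w, exists a : 'I_n -> R, w = \sum_(i < n) a i *: e i).

Definition q_orbit (R : realType) (M : manifold4 R) (q : endo_field M)
    (p : M) (x : tangent p) : 'I_4 -> tangent p :=
  fun i => iter i (@q p) x.

Definition induces_q_basis (R : realType) (M : manifold4 R) (q : endo_field M)
    (p : M) (x : tangent p) : Prop := is_basis (q_orbit q x).

Definition pairwise_orthogonal_at (R : realType) (M : manifold4 R)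
    (g : riemannian_metric M) (p : M) (n : nat) (e : 'I_n -> tangent p) : Prop :=
  forall i j, i != j -> g p (e i) (e j) = 0.

(* Main.v *)
(* In circulant coordinates, q permutes cyclically and g is diagonal in the
   discrete Fourier basis, with eigenvalues A + 2B + C on (1,1,1,1),
   A - 2B + C on (1,-1,1,-1) and A - C (twice) on the remaining plane, all
   positive.  The q-orbit of a vector is orthogonal exactly when its Fourier
   components, scaled by the square roots of these eigenvalues, have equal
   modulus; if nonzero, such a vector is nonzero in every component, so its
   orbit is a basis.  The given q-basis is used only to realize this coordinate
   vector by a tangent vector. *)
Require Import Defs.
From mathcomp Require Import all_boot all_order all_algebra.
From mathcomp Require Import all_classical all_reals all_analysis.
From mathcomp Require Import lra.

Set Implicit Arguments.
Unset Strict Implicit.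
Unset Printing Implicit Defensive.

Import Order.TTheory GRing.Theory Num.Theory.

Local Open Scope ring_scope.

(** The transformation law fixes the coordinates in the other charts around [p], and those in all
    remaining charts are 0. *)
Lemma coord_inj (R : realType) (M : manifold4 R) (p : M) (c : chart R M)
    (u v : tangent p) : chart_at p c -> u c = v c -> u = v.
Proof.
move=> pc uvc; apply/val_inj/funext => c' /=.
have /asboolP[u0 uE] := coordP u; have /asboolP[v0 vE] := coordP v.
have [pc'|npc'] := pselect (chart_at p c'); last by rewrite u0 ?v0.
by rewrite (uE _ _ pc pc') (vE _ _ pc pc') uvc.
Qed.

Definition coord_mx (R : realType) (M : manifold4 R) (p : M) (c : chart R M)
    (n : nat) (e : 'I_n -> tangent p) : 'M[R]_(n, 4) :=
  \matrix_(i < n) e i c.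

Lemma coord_lin_comb (R : realType) (M : manifold4 R) (p : M) (c : chart R M)
    (n : nat) (e : 'I_n -> tangent p) (a : 'I_n -> R) :
  (\sum_i a i *: e i) c = (\row_i a i) *m coord_mx c e.
Proof.
rewrite mulmx_sum_row.
rewrite (big_morph (fun v : tangent p => v c) (id1 := 0) (op1 := +%R)) //.
by apply: eq_bigr => i _; rewrite rowK mxE.
Qed.

Lemma is_basisP (R : realType) (M : manifold4 R) (p : M) (c : chart R M)
    (e : 'I_4 -> tangent p) : chart_at p c ->
  is_basis e <-> coord_mx c e \in unitmx.
Proof.
move=> pc; split=> [[e_free _]|e_unit]; last split=> [a ae0 i|w].
(* A left kernel vector of the coordinate matrix is a linear relation among the [e i]. *)
- rewrite -row_free_unit; apply: inj_row_free => v ve0.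
  have vE : \row_i v 0 i = v by apply/rowP => i; rewrite mxE.
  apply/rowP => i; rewrite mxE; apply: (e_free (v 0)).
  by apply: (coord_inj pc); rewrite coord_lin_comb vE.
- have: (\row_j a j) *m coord_mx c e = 0 by rewrite -coord_lin_comb ae0.
  move=> /(congr1 (mulmx^~ (invmx (coord_mx c e)))).
  by rewrite mulmxK // mul0mx => /rowP/(_ i); rewrite !mxE.
- pose a := w c *m invmx (coord_mx c e); exists (a 0).
  apply: (coord_inj pc); rewrite coord_lin_comb.
  have -> : \row_i a 0 i = a by apply/rowP => i; rewrite mxE.
  by rewrite mulmxKV.
Qed.

Lemma gram_coordE (R : realType) (M : manifold4 R)
    (g : forall p : M, tangent p -> tangent p -> R) (c : chart R M)
    (G : 'rV[R]_4 -> 'M[R]_4) (p : M) (n : nat) (e : 'I_n -> tangent p) i j :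
  metric_in_chart g c G -> cdom c p ->
  g p (e i) (e j) = (coord_mx c e *m G (c p) *m (coord_mx c e)^T) i j.
Proof.
move=> gG cp; rewrite (gG _ cp) exchange_big mxE; apply: eq_bigr => k _ /=.
rewrite !mxE mulr_suml; apply: eq_bigr => l _.
by rewrite !mxE [in RHS](mulrC (e i c 0 l)).
Qed.

(** The sum [i + j] is taken in ['I_4], hence modulo 4: row [i] is [w] shifted cyclically [i]
    times. *)
Definition circulant_rows (R : realType) (w : 'rV[R]_4) : 'M[R]_4 :=
  \matrix_(i, j) w 0 (i + j).

Lemma coord_mx_q_orbit (R : realType) (M : manifold4 R) (q : endo_field M)
    (c : chart R M) (p : M) (y : tangent p) :
  endo_in_chart q c (fun=> q_mx R) -> cdom c p ->
  coord_mx c (q_orbit q y) = circulant_rows (y c).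
Proof.
move=> qQ cp.
have shift k j : iter k (@q p) y c 0 j = y c 0 (k%:R + j).
  elim: k j => [|k IHk] j; first by rewrite add0r.
  rewrite iterS (qQ _ cp) -natr1 -addrA -[RHS]IHk.
  (* Row [j] of [q_mx] has its only nonzero entry in column [1 + j], modulo 4. *)
  rewrite mxE (bigD1 (1 + j)) //= big1 => [|s sj].
    by rewrite addr0 !mxE; case: j => [[|[|[|[|//]]]] j4] /=; rewrite mulr1.
  rewrite !mxE.
  case: j s sj => [[|[|[|[|//]]]] j4] [[|[|[|[|//]]]] s4] //= _; exact: mulr0.
by apply/matrixP => i j; rewrite !mxE shift natr_Zp.
Qed.

(** The constant 16 is the squared length of [w]: 4 from each of the four Fourier modes, two of
    which make up the plane of eigenvalue [A - C]. *)
Lemma circulant_orthogonalization (R : realType) (A B C : R) :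
  0 < B -> B < C -> C < A ->
  exists w : 'rV[R]_4,
    circulant_rows w *m metric_mx A B C *m (circulant_rows w)^T = 16%:M.
Proof.
move=> B_gt0 BC CA.
have l0 : 0 < A + 2 * B + C by lra.
have l2 : 0 < A - 2 * B + C by lra.
have l1 : 0 < A - C by lra.
have root l : 0 < l -> exists a : R, l * a ^+ 2 = 1.
  move=> l_gt0; exists (Num.sqrt l)^-1.
  by rewrite exprVn sqr_sqrtr ?ltW // divff // gt_eqF.
have [a aE] := root _ l0; have [b bE] := root _ l2; have [d dE] := root _ l1.
(* a (1,1,1,1) + b (1,-1,1,-1) + 2 d (1,0,-1,0) *)
exists (\row_j nth 0 [:: a + b + 2 * d; a - b; a + b - 2 * d; a - b] j).
apply/matrixP => i j.
do 2!(rewrite !mxE !big_ord_recr !big_ord0 /=).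
(* Products of distinct scalars among [a], [b], [d] cancel, so each entry is a linear combination of
   [aE], [bE] and [dE]. *)
case: i => [[|[|[|[|//]]]] i4]; case: j => [[|[|[|[|//]]]] j4];
  rewrite ?mxE ?big_ord_recr ?big_ord0 /= ?mxE /= ?mulr1n ?mulr0n;
  lra.
Qed.

Theorem theorem3p4 (R : realType) (M : manifold4 R)
    (g : riemannian_metric M) (q : endo_field M)
    (gq_circulant : circulant_structure g q)
    (p : M) (x : tangent p) (x_q_basis : induces_q_basis q x) :
  exists y : tangent p,
    induces_q_basis q y /\ pairwise_orthogonal_at g (q_orbit q y).
Proof.
have [c [pc [A [B [C [_ ABC gG qQ]]]]]] := gq_circulant p.
have cp : cdom c p by case: pc.
have [B_gt0 BC CA] := ABC (c p) (imageP c cp).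
have [w wG] := circulant_orthogonalization B_gt0 BC CA.
pose X := coord_mx c (q_orbit q x); pose a := w *m invmx X.
pose y := \sum_i a 0 i *: q_orbit q x i.
have yc : y c = w.
  rewrite coord_lin_comb.
  have -> : \row_i a 0 i = a by apply/rowP => i; rewrite mxE.
  by rewrite mulmxKV //; apply/(is_basisP _ pc).
have Y : coord_mx c (q_orbit q y) = circulant_rows w.
  by rewrite (coord_mx_q_orbit _ qQ cp) yc.
exists y; split=> [|i j ij].
  apply/(is_basisP _ pc); rewrite Y.
  (* The Gram matrix is an invertible scalar matrix, so its factor [circulant_rows w] is invertible
     too. *)
  have : circulant_rows w *m metric_mx (A (c p)) (B (c p)) (C (c p)) *m
      (circulant_rows w)^T \in unitmx.
    by rewrite wG unitmxE det_scalar unitfE expf_neq0 ?pnatr_eq0.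
  by rewrite unitmx_mul => /andP[_]; rewrite unitmx_tr.
by rewrite (gram_coordE _ _ _ gG cp) Y wG mxE (negPf ij).
Qed.
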